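(* Let $l\ge1$ be an integer, let $\{m_k\}_{k\ge1}$ be an enumeration (in any order) of the integers in $\mathcal D^*(l)$, let $T=\{t_{n,m}\}$ be a summation matrix satisfying conditions 1)–3) of the context, and let $a_k$, $k\ge1$, be real numbers. If $$\sup_n\left|\sum_{k=1}^\infty t_{n,k}a_kw_{m_k}(x)\right|<\infty$$ for every $x$ in a measurable set $E\subset(0,1)$ of Lebesgue measure $|E|>1-2^{-4l}$, then $\sum_k a_k^2<\infty$.
   Context: For an integer $s\ge1$, $\mathcal D(s)$ is the set of integers of the form $m=2^{k_1}+2^{k_2}+\dots+2^{k_s}$ with integers $k_1>k_2>\dots>k_s\ge1$, and $\mathcal D^*(l)=\bigcup_{1\le s\le l}\mathcal D(s)$. The Rademacher functions are $r_n(x)=\operatorname{sign}(\sin 2^n\pi x)$, $x\in(0,1)$, $n\ge1$, and the Walsh function for such $m$ is $w_m(x)=r_{k_1}(x)r_{k_2}(x)\cdots r_{k_s}(x)$. Conditions on a matrix $T=\{t_{n,m}:\ m\in\mathbb Z,\ n=1,2,\ldots\}$ of numbers: 1) for each $n$ only finitely many of the $t_{n,m}$, $m\in\mathbb Z$, are nonzero; 2) there is a constant $M$ with $|t_{n,m}|\le M$ for all $n,m$; 3) $\lim_{n\to\infty}t_{n,m}=1$ for every $m=1,2,\ldots$. *)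

(* Defs.v *)
From HB Require Import structures.
From mathcomp Require Import all_boot all_order all_algebra.
From mathcomp Require Import all_classical all_reals all_analysis.
From mathcomp Require Import complex.
Import Order.TTheory GRing.Theory Num.Theory.
Import numFieldNormedType.Exports.

Set Implicit Arguments.
Unset Strict Implicit.
Unset Printing Implicit Defensive.

Local Open Scope classical_set_scope.
Local Open Scope ring_scope.

(* Dset s: sums 2 ^ k_1 + ... + 2 ^ k_s with k_1 > ... > k_s >= 1. *)
Definition Dset (s : nat) : set nat :=
  [set m | exists ks : seq nat,
    [/\ size ks = s, sorted gtn ks, all (leq 1) ks &
        m = (\sum_(k <- ks) 2 ^ k)%N]].

Definition Dstar (l : nat) : set nat :=
  \bigcup_(s in [set s : nat | (1 <= s <= l)%N]) Dset s.

Definition rademacher (R : realType) (n : nat) (x : R) : R :=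
  Num.sg (sin (2 ^+ n * pi * x)).

(* The product runs over the positions k >= 1 of the binary digits 1 of m; the
   lemma walshE below relates it to the decompositions used in Dset. *)
Definition walsh (R : realType) (m : nat) (x : R) : R :=
  \prod_(1 <= k < m.+1 | odd (m %/ 2 ^ k)) rademacher k x.

Lemma sum_pow2_lt (k : nat) (ks : seq nat) :
  path gtn k ks -> (\sum_(i <- ks) 2 ^ i < 2 ^ k)%N.
Proof.
elim: ks k => [|j s IH] k /=; first by rewrite big_nil expn_gt0.
case/andP=> jk /IH sj; rewrite big_cons.
have : (2 ^ j.+1 <= 2 ^ k)%N by rewrite leq_exp2l.
by apply: leq_trans; rewrite expnS mul2n -addnn ltn_add2l.
Qed.

Lemma odd_sum_pow2 (ks : seq nat) (j : nat) : sorted gtn ks ->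
  odd ((\sum_(k <- ks) 2 ^ k) %/ 2 ^ j) = (j \in ks).
Proof.
elim: ks => [|k s IH] /=; first by rewrite big_nil div0n in_nil.
move=> pks; have ltS := sum_pow2_lt pks.
have {}IH := IH (path_sorted pks).
rewrite big_cons in_cons; have [jk|kj] := leqP j k.
  rewrite -{1}(subnK jk) expnD divnMDl ?expn_gt0// oddD oddX/= IH orbF.
  rewrite subn_eq0; have [ejk|nejk] := eqVneq j k.
    subst j; rewrite leqnn /=.
    have /negbTE -> // : k \notin s.
    apply/negP => ks; have := order_path_min (rev_trans ltn_trans) pks.
    by move=> /allP/(_ _ ks) /=; rewrite ltnn.
  by rewrite leqNgt ltn_neqAle nejk jk.
rewrite divn_small; last first.
  apply: (@leq_trans (2 ^ k.+1)); last by rewrite leq_exp2l.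
  by rewrite expnS mul2n -addnn ltn_add2l.
rewrite gtn_eqF//=; apply/esym/negP => js.
have := order_path_min (rev_trans ltn_trans) pks.
by move=> /allP/(_ _ js) /=; rewrite ltnNge (ltnW kj).
Qed.

Lemma walshE (R : realType) (ks : seq nat) (x : R) :
  sorted gtn ks -> all (leq 1) ks ->
  walsh (\sum_(k <- ks) 2 ^ k)%N x = \prod_(k <- ks) rademacher k x.
Proof.
move=> sks pks; rewrite /walsh -big_filter; apply: perm_big.
apply: uniq_perm; first exact/filter_uniq/iota_uniq.
  exact: (sorted_uniq (rev_trans ltn_trans) ltnn).
move=> k; rewrite mem_filter odd_sum_pow2// mem_index_iota.
case: (boolP (k \in ks)) => //= kks.
rewrite (allP pks _ kks) /= ltnS.
by rewrite (big_rem k)//= (leq_trans (ltnW (ltn_expl k (ltnSn 1))))// leq_addr.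
Qed.

(* The entries are complex; R[i]^o is R[i] viewed as a normed module over
   itself, which provides the topology of the complex plane. *)
Definition summation_matrix (R : realType) (T : nat -> int -> R[i]^o) : Prop :=
  [/\ forall n : nat, (1 <= n)%N -> finite_set [set m : int | T n m != 0],
      exists M : R, forall (n : nat) (m : int), (1 <= n)%N ->
        Normc.normc (T n m) <= M
    & forall m : nat, (1 <= m)%N ->
        T n m%:Z @[n --> \oo] --> (1 : R[i]^o)].

(* Lebesgue (not only Borel) measurability, i.e. membership in the domain of
   completed_lebesgue_measure. *)
Definition lebesgue_measurable (R : realType) (E : set R) : Prop :=
  ((wlength idfun)^*%mu).-cara.-measurable E.

(* The sum of T n k * u k over k >= 1, as the limit of its partial sums. *)
Definition summation_mean (R : realType) (T : nat -> int -> R[i]^o)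
    (u : nat -> R) (n : nat) : R[i]^o :=
  lim ((\sum_(1 <= k < N) T n k%:Z * (u k)%:C%C : R[i]^o) @[N --> \oo]).

(* Main.v *)
Require Import Defs.
From HB Require Import structures.
From mathcomp Require Import all_boot all_order all_algebra.
From mathcomp Require Import all_classical all_reals all_analysis.
From mathcomp Require Import complex.
From mathcomp Require Import measurable_realfun ring lra.
Import Order.TTheory GRing.Theory Num.Theory.
Import numFieldNormedType.Exports.

Set Implicit Arguments.
Unset Strict Implicit.
Unset Printing Implicit Defensive.

Local Open Scope classical_set_scope.
Local Open Scope ring_scope.

(* The sets F_N on which all the real parts of the means are bounded by N are
   Borel and increase to a set containing E, so |F_N| > 1 - 2^{-4l} for some N.
   The real part f of a mean is a Walsh polynomial of order at most l, constant
   on the dyadic intervals of some level, and |f| <= N on each interval that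
   F_N meets; the other ones have total length at most 2^{-4l}.  By
   Cauchy-Schwarz and Bonami's inequality ||f||_4^4 <= 9^l ||f||_2^4, they
   contribute at most (2^{-4l} 9^l)^{1/2} <= 3/4 of ||f||_2^2, whence
   ||f||_2^2 <= 4 N^2.  By orthogonality this bounds the sum of
   (Re t_{n,k} a_k)^2, and n tends to infinity. *)

(** * Finite sums and binary digits *)

Lemma CauchySchwarz_sum (R : realDomainType) (I : Type) (r : seq I) (P : pred I)
    (u v : I -> R) :
  (\sum_(i <- r | P i) u i * v i) ^+ 2 <=
  (\sum_(i <- r | P i) u i ^+ 2) * (\sum_(i <- r | P i) v i ^+ 2).
Proof.
set U := \sum_(i <- r | P i) u i ^+ 2; set V := \sum_(i <- r | P i) v i ^+ 2.
set W := \sum_(i <- r | P i) u i * v i.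
(* Lagrange's identity: this double sum equals [2 * (U * V - W ^+ 2)]. *)
have : 0 <= \sum_(i <- r | P i) \sum_(j <- r | P j) (u i * v j - u j * v i) ^+ 2.
  by apply: sumr_ge0 => i _; apply: sumr_ge0 => j _; exact: sqr_ge0.
have -> : \sum_(i <- r | P i) \sum_(j <- r | P j) (u i * v j - u j * v i) ^+ 2 =
    \sum_(i <- r | P i) (u i ^+ 2 * V + U * v i ^+ 2 - 2 * (u i * v i) * W).
  apply: eq_bigr => i _; rewrite mulr_sumr mulr_suml mulr_sumr -big_split -sumrB.
  by apply: eq_bigr => j _ /=; ring.
rewrite sumrB big_split -mulr_suml -!mulr_sumr -mulr_suml -mulr_sumr -/U -/V -/W.
by move=> /= ?; nra.
Qed.

Lemma big_nat_doubling (V : nmodType) (n : nat) (F : nat -> V) :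
  \sum_(0 <= j < n.*2) F j = \sum_(0 <= j < n) (F j.*2 + F j.*2.+1).
Proof.
elim: n => [|n IH]; first by rewrite !big_geq.
by rewrite doubleS !big_nat_recr//= IH addrA.
Qed.

Lemma big_nat_pow2S (V : nmodType) (K : nat) (F : nat -> V) :
  \sum_(0 <= m < 2 ^ K.+1) F m =
  \sum_(0 <= m < 2 ^ K) F m + \sum_(0 <= m < 2 ^ K) F (2 ^ K + m)%N.
Proof.
rewrite expnS mul2n -addnn (big_cat_nat (n := 2 ^ K)) ?leq_addr//=; congr (_ + _).
rewrite -{1}[(2 ^ K)%N]add0n big_addn addnK.
by apply: eq_bigr => i _; rewrite addnC.
Qed.

Lemma odd_div_pow2D (K i m : nat) : (i < K)%N ->
  odd ((2 ^ K + m) %/ 2 ^ i) = odd (m %/ 2 ^ i).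
Proof.
move=> iK; rewrite -{1}(subnK (ltnW iK)) expnD divnMDl ?expn_gt0//.
by rewrite oddD oddX subn_eq0 leqNgt iK.
Qed.

Lemma odd_div_pow2_top (K m : nat) : (m < 2 ^ K)%N ->
  odd ((2 ^ K + m) %/ 2 ^ K).
Proof. by move=> mK; rewrite divnDl// divnn expn_gt0 divn_small. Qed.

(** For [m < 2 ^ K] this is the number of Rademacher factors of [walsh m.*2]. *)
Definition popcount (K m : nat) := (\sum_(0 <= i < K) odd (m %/ 2 ^ i))%N.

Lemma popcount_low (K m : nat) : (m < 2 ^ K)%N -> popcount K.+1 m = popcount K m.
Proof. by move=> mK; rewrite /popcount big_nat_recr//= divn_small// addn0. Qed.

Lemma popcount_high (K m : nat) :
  (m < 2 ^ K)%N -> popcount K.+1 (2 ^ K + m) = (popcount K m).+1.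
Proof.
move=> mK; rewrite /popcount big_nat_recr//= odd_div_pow2_top// addn1.
by congr _.+1; apply: eq_big_nat => i /andP[_ iK]; rewrite odd_div_pow2D.
Qed.

(* The value on the j-th dyadic interval of length [2 ^- K] of the Walsh
   polynomial in which [c m] is the coefficient of [walsh m.*2]: the
   Rademacher functions are numbered from 1, the binary digits from 0.  The halves of the j-th interval are the
   intervals [j.*2] and [j.*2.+1] of the next level. *)
Fixpoint chaos (R : pzRingType) (K : nat) (c : nat -> R) (j : nat) : R :=
  if K is K'.+1 then
    chaos K' c j./2 + (-1) ^+ odd j * chaos K' (fun m => c (2 ^ K' + m)%N) j./2
  else c 0%N.

(** Intervals are numbered from left to right, so the sign of Rademacher function [i.+1] is read off
    the digit [K - i.+1] of [j]. *)
Lemma chaosE (R : comPzRingType) (K : nat) (c : nat -> R) (j : nat) :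
  chaos K c j = \sum_(0 <= m < 2 ^ K) c m *
    \prod_(0 <= i < K | odd (m %/ 2 ^ i)) (-1) ^+ (odd (j %/ 2 ^ (K - i.+1))).
Proof.
elim: K c j => [|K IH] c j.
  by rewrite expn0 big_nat1 big_geq// mulr1.
have halfE i : (i < K)%N -> (j./2 %/ 2 ^ (K - i.+1) = j %/ 2 ^ (K.+1 - i.+1))%N.
  by move=> iK; rewrite -divn2 -divnMA -expnS subSS -subSn.
rewrite /= !IH big_nat_pow2S; congr (_ + _).
  apply: eq_big_nat => m /andP[_ mK]; congr (_ * _).
  rewrite [RHS]big_mkcond big_nat_recr//= divn_small//= mulr1 big_mkcond.
  by apply: eq_big_nat => i /andP[_ iK]; rewrite halfE.
rewrite mulr_sumr; apply: eq_big_nat => m /andP[_ mK].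
rewrite mulrCA; congr (_ * _).
rewrite [RHS]big_mkcond big_nat_recr//= odd_div_pow2_top// mulrC subnn divn1.
congr (_ * _); rewrite big_mkcond/=; apply: eq_big_nat => i /andP[_ iK].
by rewrite odd_div_pow2D// halfE.
Qed.

(** * Moments of Walsh polynomials: Parseval and hypercontractivity *)

(** The last Rademacher function takes opposite signs on the two halves of an interval. With [G] a
    square or a fourth power, this is the induction step on [K] for both moments. *)
Lemma chaos_sum (R : pzRingType) (K : nat) (c : nat -> R) (G : R -> R) :
  let c' := fun m => c (2 ^ K + m)%N in
  \sum_(0 <= j < 2 ^ K.+1) G (chaos K.+1 c j) =
  \sum_(0 <= j < 2 ^ K) (G (chaos K c j + chaos K c' j) +
                         G (chaos K c j - chaos K c' j)).
Proof.
rewrite /= expnS mul2n big_nat_doubling; apply: eq_bigr => j _ /=.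
by rewrite !doubleK uphalf_double odd_double/= expr0 expr1 mul1r mulN1r.
Qed.

Lemma chaos_parseval (R : comPzRingType) (K : nat) (c : nat -> R) :
  \sum_(0 <= j < 2 ^ K) chaos K c j ^+ 2 = 2 ^+ K * \sum_(0 <= m < 2 ^ K) c m ^+ 2.
Proof.
elim: K c => [|K IH] c; first by rewrite expn0 !big_nat1 mul1r.
rewrite (chaos_sum K c (fun x => x ^+ 2)).
rewrite big_nat_pow2S mulrDr exprS -!mulrA -!IH -mulrDr -big_split mulr_sumr/=.
by apply: eq_bigr => j _; ring.
Qed.

(* Bonami's lemma: (2, 4)-hypercontractivity, by induction on the number of
   Rademacher functions. *)
Lemma chaos_hypercontractive (R : realDomainType) (K d : nat) (c : nat -> R) :
  (forall m, (m < 2 ^ K)%N -> (d < popcount K m)%N -> c m = 0) ->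
  \sum_(0 <= j < 2 ^ K) chaos K c j ^+ 4 <=
  2 ^+ K * 9 ^+ d * (\sum_(0 <= m < 2 ^ K) c m ^+ 2) ^+ 2.
Proof.
elim: K d c => [|K IH] d c cd.
  rewrite expn0 !big_nat1 expr0 mul1r /= -exprM ler_peMl ?exprn_even_ge0//.
  by rewrite exprn_ege1// ler1n.
have lt0 m : (m < 2 ^ K)%N -> (m < 2 ^ K.+1)%N.
  by move=> mK; rewrite expnS mul2n -addnn ltn_addr.
have lt1 m : (m < 2 ^ K)%N -> (2 ^ K + m < 2 ^ K.+1)%N.
  by move=> mK; rewrite expnS mul2n -addnn ltn_add2l.
rewrite (chaos_sum K c (fun x => x ^+ 4)) big_nat_pow2S /=.
set c' := fun m => c (2 ^ K + m)%N.
set A := \sum_(0 <= m < 2 ^ K) c m ^+ 2.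
have [A0 P0] : 0 <= A /\ (0 : R) <= 2 ^+ K.
  by split; [apply: sumr_ge0 => ? _; rewrite sqr_ge0 | rewrite exprn_ge0].
have Hg := IH d c (fun m mK dm => cd m (lt0 m mK)
  (eq_ind_r (fun p => (d < p)%N) dm (popcount_low mK))).
rewrite -/A in Hg.
set B := \sum_(0 <= m < 2 ^ K) c (2 ^ K + m)%N ^+ 2.
have B0 : 0 <= B by apply: sumr_ge0 => ? _; rewrite sqr_ge0.
(* In the sum of the fourth powers of g + h and g - h the odd powers cancel. *)
rewrite (eq_bigr (fun j => 2 * chaos K c j ^+ 4 +
  12 * (chaos K c j ^+ 2 * chaos K c' j ^+ 2) + 2 * chaos K c' j ^+ 4)); last first.
  by move=> j _; ring.
rewrite 2!big_split/= -!mulr_sumr.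
have := CauchySchwarz_sum (index_iota 0 (2 ^ K)) predT
  (fun j => chaos K c j ^+ 2) (fun j => chaos K c' j ^+ 2).
under [X in _ <= X * _]eq_bigr do rewrite -exprM.
under [X in _ <= _ * X]eq_bigr do rewrite -exprM.
rewrite /=.
set G4 := \sum_(0 <= j < 2 ^ K) chaos K c j ^+ 4 in Hg *.
set H4 := \sum_(0 <= j < 2 ^ K) chaos K c' j ^+ 4.
set GH := \sum_(0 <= j < 2 ^ K) _.
have G40 : 0 <= G4 by apply: sumr_ge0 => ? _; rewrite exprn_even_ge0.
have H40 : 0 <= H4 by apply: sumr_ge0 => ? _; rewrite exprn_even_ge0.
move=> CS; rewrite exprS; set P := 2 ^+ K in P0 Hg *.
(* If [d = 0], every coefficient of the upper half vanishes, its index having a digit 1, and only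
   [G4] survives. *)
case: d => [|d] in cd Hg *.
  have B_0 : B = 0.
    rewrite /B big_nat_cond big1// => m /andP[/andP[_ mK] _].
    by rewrite cd ?expr0n// ?lt1// popcount_high.
  have H4_0 : H4 = 0.
    apply/le_anti; rewrite H40 andbT; apply: le_trans (IH 0%N c' _) _.
      by move=> m mK _; apply: cd; rewrite ?lt1// popcount_high.
    by rewrite -/B B_0 expr0n mulr0.
  have GH0 : GH = 0.
    apply/eqP; rewrite -sqrf_eq0 eq_le sqr_ge0 andbT.
    by rewrite (le_trans CS)// H4_0 mulr0.
  by rewrite GH0 H4_0 B_0 !(mulr0, addr0) -2!mulrA ler_pM2l// mulrA.
(* The top digit uses up one factor, so [c'] has order one less and saves a factor 9. *)
have Hh : H4 <= P * 9 ^+ d * B ^+ 2.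
  apply: (IH d c') => m mK dm; apply: cd; first exact: lt1.
  by rewrite popcount_high.
rewrite exprS in Hg *; set Q := 9 ^+ d in Hg Hh *.
have Q0 : 0 <= Q by rewrite exprn_ge0.
have HGH : GH <= 3 * P * Q * A * B.
  apply: (@le_trans _ _ `|GH|); first exact: ler_norm.
  rewrite -ler_sqr ?nnegrE ?normr_ge0 ?mulr_ge0// real_normK ?num_real//.
  apply: le_trans CS (le_trans (ler_pM G40 H40 Hg Hh) _).
  by rewrite le_eqVlt; apply/orP; left; apply/eqP; ring.
have PQ0 : 0 <= P * Q * B ^+ 2 by rewrite !mulr_ge0// sqr_ge0.
(* The cross terms agree exactly, [12 * 3 = 2 * 9 * 2]: this is what dictates the constant 9. The
   [B ^+ 2] terms leave slack. *)
rewrite (_ : 2 * P * (9 * Q) * (A + B) ^+ 2 =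
  2 * (P * (9 * Q) * A ^+ 2) + 12 * (3 * P * Q * A * B) +
  18 * (P * Q * B ^+ 2)); last ring.
lra.
Qed.

(** [B] marks the intervals without control. They carry at most 3/4 of the second moment, so a
    quarter of it is bounded by [N ^+ 2]. *)
Lemma chaos_coeff_bound (R : realFieldType) (K d : nat) (c : nat -> R)
    (B : pred nat) (N : R) : (1 <= d)%N ->
  (forall m, (m < 2 ^ K)%N -> (d < popcount K m)%N -> c m = 0) ->
  0 <= N ->
  (forall j, (j < 2 ^ K)%N -> ~~ B j -> `|chaos K c j| <= N) ->
  (\sum_(0 <= j < 2 ^ K | B j) 1) <= 2 ^+ K * 2 ^- (4 * d) :> R ->
  \sum_(0 <= m < 2 ^ K) c m ^+ 2 <= 4 * N ^+ 2.
Proof.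
move=> d1 cd N0 cN HB.
set X := \sum_(0 <= m < 2 ^ K) c m ^+ 2.
have X0 : 0 <= X by apply: sumr_ge0 => ? _; rewrite sqr_ge0.
have P0 : (0 : R) < 2 ^+ K by rewrite exprn_gt0.
have /esym L2 := chaos_parseval K c; rewrite -/X in L2.
have L4 := chaos_hypercontractive cd; rewrite -/X in L4.
set P := 2 ^+ K in HB P0 L2 L4.
rewrite (bigID B)/= in L2.
set S := \sum_(_ <= _ < _ | B _) _ in L2.
set S' := \sum_(_ <= _ < _ | ~~ B _) _ in L2.
have S'N : S' <= P * N ^+ 2.
  apply: (@le_trans _ _ (\sum_(0 <= j < 2 ^ K) N ^+ 2)).
    rewrite /S' big_mkcond/= !big_nat; apply: ler_sum => j jK.
    case: ifPn => Bj; last exact: sqr_ge0.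
    rewrite -[X in X <= _]real_normK ?num_real// ler_sqr ?nnegrE//.
    by apply: cN => //; case/andP: jK.
  by rewrite sumr_const_nat subn0 -[X in X <= _]mulr_natl natrX.
have CS := CauchySchwarz_sum (index_iota 0 (2 ^ K)) B
  (fun=> 1) (fun j => chaos K c j ^+ 2).
have S4 : \sum_(0 <= j < 2 ^ K | B j) (chaos K c j ^+ 2) ^+ 2 <=
    P * 9 ^+ d * X ^+ 2.
  apply: le_trans L4; rewrite big_mkcond; apply: ler_sum => j _.
  by case: ifP => _; [rewrite -exprM | rewrite exprn_even_ge0].
(* The left side is (9/16)^d, at most 9/16 because [d >= 1]. *)
have q34 : 2 ^- (4 * d) * 9 ^+ d <= (3 / 4) ^+ 2 :> R.
  rewrite exprM -exprVn -exprMn.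
  have -> : (2 ^+ 4)^-1 * 9 = (3 / 4) ^+ 2 :> R by field.
  by rewrite -[leRHS]expr1 ler_wiXn2l//; lra.
have S0 : 0 <= S by apply: sumr_ge0 => ? _; rewrite sqr_ge0.
have : S <= 3 / 4 * P * X.
  have PX0 : 0 <= 3 / 4 * P * X by rewrite mulr_ge0// mulr_ge0 ?(ltW P0)//; lra.
  rewrite -ler_sqr ?nnegrE//.
  have -> : S = \sum_(0 <= j < 2 ^ K | B j) 1 * chaos K c j ^+ 2.
    by apply: eq_bigr => j _; rewrite mul1r.
  apply: le_trans CS _; rewrite (eq_bigr (fun=> 1)); last by move=> *; rewrite expr1n.
  apply: (@le_trans _ _ ((P * 2 ^- (4 * d)) * (P * 9 ^+ d * X ^+ 2))).
    by apply: ler_pM => //; apply: sumr_ge0 => *; rewrite ?sqr_ge0.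
  rewrite (_ : _ * _ = P ^+ 2 * X ^+ 2 * (2 ^- (4 * d) * 9 ^+ d)); last by ring.
  rewrite (_ : (3 / 4 * P * X) ^+ 2 = P ^+ 2 * X ^+ 2 * (3 / 4) ^+ 2); last by ring.
  by apply: ler_wpM2l => //; rewrite mulr_ge0// sqr_ge0.
move=> SS; rewrite -(ler_pM2l P0); lra.
Qed.

(** * Rademacher and Walsh functions on dyadic intervals *)

Lemma sgr_sin_pi (R : realType) (q : nat) (y : R) :
  q%:R < y < q.+1%:R -> Num.sg (sin (y * pi)) = (-1) ^+ odd q.
Proof.
elim: q y => [|q IH] y /andP[y1 y2].
  by rewrite gtr0_sg// sin_gt0_pi// mulr_gt0 ?pi_gt0//= gtr_pMl ?pi_gt0.
have -> : y * pi = (y - 1) * pi + pi by ring.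
rewrite sinDpi sgrN IH ?oddS ?signrN//.
by rewrite ltrBrDr ltrBlDr -!natr1 in y1 y2 *; rewrite y1.
Qed.

(** The [j]-th interval of level [K] lies in the interval of level [i.+1] with number
    [j %/ 2 ^ (K - i.+1)], inside which the sine keeps its sign. *)
Lemma rademacher_cell (R : realType) (K i j : nat) (x : R) : (i < K)%N ->
  j%:R < x * 2 ^+ K < j.+1%:R ->
  rademacher i.+1 x = (-1) ^+ odd (j %/ 2 ^ (K - i.+1)).
Proof.
move=> iK /andP[x1 x2]; rewrite /rademacher mulrAC.
apply: sgr_sin_pi; set e := (K - i.+1)%N.
have eK : 2 ^+ K = 2 ^+ i.+1 * 2 ^+ e :> R by rewrite -exprD subnKC.
have e0 : (0 : R) < 2 ^+ e by rewrite exprn_gt0.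
have q1 : (j %/ 2 ^ e)%:R * 2 ^+ e <= j%:R :> R.
  by rewrite -natrX -natrM ler_nat leq_trunc_div.
have q2 : j.+1%:R <= (j %/ 2 ^ e).+1%:R * 2 ^+ e :> R.
  by rewrite -natrX -natrM ler_nat ltn_ceil// expn_gt0.
rewrite eK in x1 x2; apply/andP; split; rewrite -(ltr_pM2r e0).
  by apply: le_lt_trans q1 _; lra.
lra.
Qed.

Lemma big_bits (R : Type) (idx : R) (op : Monoid.law idx) (p q mu : nat)
    (F : nat -> R) :
  (mu < 2 ^ p)%N -> (p <= q)%N ->
  \big[op/idx]_(0 <= i < q | odd (mu %/ 2 ^ i)) F i =
  \big[op/idx]_(0 <= i < p | odd (mu %/ 2 ^ i)) F i.
Proof.
move=> mup pq; rewrite (big_cat_nat (n := p))//=.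
rewrite [X in op _ X]big_nat_cond [X in op _ X]big1 ?Monoid.mulm1//.
move=> i /andP[/andP[pi _]]; rewrite divn_small//.
by rewrite (leq_trans mup)// leq_exp2l.
Qed.

(** The exponents are at least 1, so [x] is even; [S] sends the nonzero digit positions of its half
    injectively into the at most [l] exponents. *)
Lemma Dstar_half (l x : nat) : Dstar l x ->
  x = (x./2).*2 /\ forall K, (popcount K x./2 <= l)%N.
Proof.
case=> s /= /andP[_ sl] [ks [sks pks ge1 xE]].
have odd0 : odd x = false.
  rewrite -[x]divn1 -[X in (x %/ X)%N](expn0 2) xE odd_sum_pow2//.
  by apply/negP => /(allP ge1).
split; first by rewrite -[LHS]odd_double_half odd0.
move=> K; rewrite (leq_trans _ sl)// -sks /popcount.
rewrite (eq_bigr (fun i => if i.+1 \in ks then 1%N else 0%N)); last first.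
  by move=> i _; rewrite -divn2 -divnMA -expnS xE odd_sum_pow2//; case: ifP.
rewrite -big_mkcond sum1_count -size_filter -(size_map S).
apply: uniq_leq_size.
  by rewrite map_inj_uniq ?filter_uniq ?iota_uniq//; exact: succn_inj.
by move=> _ /mapP[i + ->]; rewrite mem_filter => /andP[].
Qed.

Lemma measurable_sgr (R : realType) : measurable_fun setT (@Num.sg R).
Proof.
rewrite (_ : Num.sg = fun x : R => if 0 < x then 1 else if x < 0 then -1 else 0).
  apply: measurable_fun_ifT => //; first exact: measurable_fun_ltr.
  by apply: measurable_fun_ifT => //; exact: measurable_fun_ltr.
by apply/funext => x; case: ltrgt0P => [/gtr0_sg|/ltr0_sg|->]//; exact: sgr0.
Qed.

Lemma measurable_walsh (R : realType) (m : nat) : measurable_fun setT (@walsh R m).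
Proof.
rewrite /walsh; under eq_fun do rewrite -big_filter.
apply: measurable_prod => k _; apply: measurableT_comp; first exact: measurable_sgr.
apply: measurableT_comp; first by apply: continuous_measurable_fun; exact: continuous_sin.
exact: measurable_funM.
Qed.

Lemma walsh_cell (R : realType) (K mu j : nat) (x : R) : (mu < 2 ^ K)%N ->
  j%:R < x * 2 ^+ K < j.+1%:R ->
  walsh mu.*2 x =
  \prod_(0 <= i < K | odd (mu %/ 2 ^ i)) (-1) ^+ odd (j %/ 2 ^ (K - i.+1)).
Proof.
move=> muK xj; rewrite /walsh big_add1/=.
rewrite (eq_bigl (fun i => odd (mu %/ 2 ^ i))); last first.
  by move=> i; rewrite expnS divnMA divn2 doubleK.
(* [walsh] stops at [mu.*2], the target at [K]; both products extend to the maximum of the two, as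
   [mu] has no digits beyond either. *)
have mu2 : (mu < 2 ^ mu.*2)%N.
  by rewrite (leq_trans (ltn_expl mu (ltnSn 1)))// leq_exp2l// -addnn leq_addr.
rewrite -(big_bits _ _ mu2 (leq_maxr K mu.*2)).
rewrite (big_bits _ _ muK (leq_maxl K mu.*2)) !(big_mkcond (fun i => odd _))/=.
by apply: eq_big_nat => i /andP[_ iK]; case: ifP => // _; exact: rademacher_cell.
Qed.

(** The coefficient at [mu] collects the terms of frequency [mu.*2]; after exchanging the sums, each
    [k] meets only its own frequency. *)
Lemma chaos_cell (R : realType) (K n : nat) (m : nat -> nat) (u : nat -> R)
    (j : nat) (x : R) :
  (forall k, (1 <= k < n)%N -> m k = (m k)./2.*2 /\ ((m k)./2 < 2 ^ K)%N) ->
  j%:R < x * 2 ^+ K < j.+1%:R ->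
  chaos K (fun mu => \sum_(1 <= k < n | (m k)./2 == mu) u k) j =
  \sum_(1 <= k < n) u k * walsh (m k) x.
Proof.
move=> mP xj; rewrite chaosE; pose W mu : R :=
  \prod_(0 <= i < K | odd (mu %/ 2 ^ i)) (-1) ^+ odd (j %/ 2 ^ (K - i.+1)).
transitivity (\sum_(0 <= mu < 2 ^ K) \sum_(1 <= k < n)
    if (m k)./2 == mu then u k * W mu else 0).
  by apply: eq_bigr => mu _; rewrite mulr_suml big_mkcond.
rewrite exchange_big/=; apply: eq_big_nat => k /mP[mk mkK].
rewrite -big_mkcond/= (eq_bigl (fun i => i == (m k)./2)); last first.
  by move=> i; rewrite eq_sym.
by rewrite big_nat1_eq/= mkK/= [X in walsh X x]mk (walsh_cell mkK xj).
Qed.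

(** * From a bound on a large set to a bound on the coefficients *)

(** Induction adds one interval at a time: its left endpoint is null, and its interior contributes
    nothing when [B] holds and at most its length otherwise. *)
Lemma dyadic_cover (R : realType) (F : set R) (K : nat) (B : pred nat) :
  measurable F ->
  (forall j, B j -> F `&` [set x | j%:R < x * 2 ^+ K < j.+1%:R] = set0) ->
  forall n : nat,
  (lebesgue_measure (F `&` [set x | 0 <= x * 2 ^+ K < n%:R]%R) <=
   (\sum_(0 <= j < n | ~~ B j) 2 ^- K)%:E)%E.
Proof.
move=> mF FB; have P0 : (0 : R) < 2 ^+ K by rewrite exprn_gt0.
have itvE a b : [set x : R | a < x * 2 ^+ K < b] = `]a * 2 ^- K, b * 2 ^- K[%classic.
  apply/seteqP; split=> x /=; rewrite in_itv/= ltr_pdivrMr// ltr_pdivlMr//.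
have itvE' a b : [set x : R | a <= x * 2 ^+ K < b] = `[a * 2 ^- K, b * 2 ^- K[%classic.
  by apply/seteqP; split=> x /=; rewrite in_itv/= ler_pdivrMr// ltr_pdivlMr.
elim=> [|n IH].
  rewrite big_geq// (_ : _ `&` _ = set0) ?measure0//.
  by apply/seteqP; split=> x //= -[_ /andP[/le_lt_trans /[apply]]]; rewrite ltxx.
have : F `&` [set x | 0 <= x * 2 ^+ K < n.+1%:R] `<=`
    (F `&` [set x | 0 <= x * 2 ^+ K < n%:R]) `|` ([set n%:R * 2 ^- K] `|`
    (F `&` [set x | n%:R < x * 2 ^+ K < n.+1%:R])).
  move=> x /= [Fx /andP[x0 xn]]; case: (ltgtP (x * 2 ^+ K) n%:R) => xn'.
  - by left; rewrite x0.
  - by right; right; rewrite xn.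
  - by right; left; rewrite -xn' mulfK// gt_eqF.
have mI a b : measurable (F `&` [set x | a < x * 2 ^+ K < b]).
  by rewrite itvE; exact: measurableI.
have mI' a b : measurable (F `&` [set x | a <= x * 2 ^+ K < b]).
  by rewrite itvE'; exact: measurableI.
have m1 (a : R) : measurable [set a] by exact: measurable_set1.
have m2 := measurableU _ _ (m1 (n%:R * 2 ^- K)) (mI n%:R n.+1%:R).
move=> /(le_measure lebesgue_measure _ _)/le_trans; apply; rewrite ?inE//.
- exact: mI'.
- by apply: measurableU; first exact: mI'.
apply: le_trans (@measureU2 _ _ _ lebesgue_measure _ _ (mI' 0 n%:R) m2) _.
rewrite big_mkcond big_nat_recr//= -big_mkcond/= EFinD; apply: (leeD IH).
apply: le_trans (@measureU2 _ _ _ lebesgue_measure _ _ (m1 _) (mI n%:R n.+1%:R)) _.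
rewrite [X in (X + _)%E]lebesgue_measure_set1 add0e.
case: ifPn => [_|/negPn/FB ->]; last by rewrite measure0.
apply: (@le_trans _ _ (lebesgue_measure [set x : R | n%:R < x * 2 ^+ K < n.+1%:R])).
  by apply: le_measure; rewrite ?inE//; [exact: mI | rewrite itvE].
rewrite itvE lebesgue_measure_itv/= lte_fin ltr_pM2r ?invr_gt0// ltr_nat ltnSn.
by rewrite -EFinD -mulrBl -natrB// subSnn mul1r.
Qed.

Lemma walsh_coeff_bound (R : realType) (l n : nat) (m : nat -> nat) (u : nat -> R)
    (F : set R) (N : R) : (1 <= l)%N ->
  set_inj [set k : nat | (1 <= k)%N] m ->
  (forall k, (1 <= k)%N -> Dstar l (m k)) ->
  measurable F -> F `<=` [set x | 0 < x < 1] ->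
  ((1 - 2 ^- (4 * l))%:E < lebesgue_measure F)%E ->
  (forall x, F x -> `|\sum_(1 <= k < n) u k * walsh (m k) x| <= N) ->
  \sum_(1 <= k < n) u k ^+ 2 <= 4 * N ^+ 2.
Proof.
move=> l1 minj mD mF F01 Fbig FN.
have half k : (1 <= k)%N -> m k = (m k)./2.*2 by move=> /mD/Dstar_half[].
(* A crude level: it dominates every half, hence [2 ^ K] exceeds them all. *)
pose K := (\sum_(1 <= k < n) (m k)./2)%N.
have mK k : (1 <= k < n)%N -> ((m k)./2 < 2 ^ K)%N.
  move=> kn; apply: leq_ltn_trans (ltn_expl K (ltnSn 1)).
  by rewrite /K (bigD1_seq k) ?mem_index_iota ?iota_uniq//= leq_addr.
pose c mu := \sum_(1 <= k < n | (m k)./2 == mu) u k.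
have -> : \sum_(1 <= k < n) u k ^+ 2 = \sum_(0 <= mu < 2 ^ K) c mu ^+ 2.
  (* By injectivity of [m] at most one [k] has a given frequency, so there are no cross terms. *)
  have cE mu : c mu ^+ 2 = \sum_(1 <= k < n | (m k)./2 == mu) u k ^+ 2.
    have [[k [kn kmu]]|nk] := pselect (exists k, (1 <= k < n)%N /\ (m k)./2 = mu).
      have kE i : (1 <= i < n)%N -> ((m i)./2 == mu) = (i == k).
        move=> /andP[i1 _]; apply/eqP/eqP => [imu|->//].
        case/andP: kn => k1 _; apply: minj; rewrite ?inE//.
        by rewrite half// imu -kmu -half.
      have sum1 (G : nat -> R) : \sum_(1 <= i < n | (m i)./2 == mu) G i = G k.
        transitivity (\sum_(1 <= i < n | i == k) G i); last by rewrite big_nat1_eq kn.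
        by rewrite big_mkcond [RHS]big_mkcond; apply: eq_big_nat => i /kE ->.
      by rewrite /c !sum1.
    by rewrite /c big_nat_cond [RHS]big_nat_cond !big1 ?expr0n//
      => i /andP[i1 /eqP imu]; case: nk; exists i.
  under [RHS]eq_bigr do rewrite cE big_mkcond.
  rewrite exchange_big/=; apply: eq_big_nat => k kn.
  rewrite -big_mkcond/= (eq_bigl (fun i => i == (m k)./2)); last first.
    by move=> i; rewrite eq_sym.
  by rewrite big_nat1_eq/= mK.
(* A point of [F] is needed to see that [N] is nonnegative. *)
have Fne : exists x, F x.
  apply: contrapT => nF; move: Fbig; rewrite (_ : F = set0); last first.
    by apply/seteqP; split=> x // Fx; case: nF; exists x.
  rewrite measure0 lte_fin ltNge subr_ge0 invf_le1 ?exprn_gt0// exprn_ege1//.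
  by rewrite ler1n.
have N0 : 0 <= N by case: Fne => x /FN; exact: le_trans.
(* The bad intervals are those whose interior misses [F]; in any other one a point of [F] bounds the
   constant value there. *)
pose B j := `[< F `&` [set x | j%:R < x * 2 ^+ K < j.+1%:R] = set0 >].
apply: (@chaos_coeff_bound R K l c B N) => //.
- move=> mu muK lmu; rewrite /c big_nat_cond big1// => k /andP[/andP[k1 _] /eqP kmu].
  by have [_ /(_ K)] := Dstar_half (mD _ k1); rewrite kmu leqNgt lmu.
- move=> j jK /asboolPn/eqP/set0P[x [Fx xj]].
  rewrite /c (@chaos_cell R K n m u j x)//; first exact: FN.
  by move=> k kn; split; [apply: half; case/andP: kn | exact: mK].
have P0 : (0 : R) < 2 ^+ K by rewrite exprn_gt0.
(* The remaining intervals cover [F] up to null sets and all lengths add up to 1, so the bad ones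
   total at most [2 ^- (4 * l)]. *)
have := @dyadic_cover R F K B mF (fun j => @asboolW _) (2 ^ K).
rewrite (_ : _ `&` _ = F); last first.
  apply/seteqP; split=> [x []//|x Fx]; split=> //=.
  have /andP[x0 x1] := F01 _ Fx.
  by rewrite natrX mulr_ge0 ?(ltW x0) ?(ltW P0)//= gtr_pMl.
move=> /(lt_le_trans Fbig); rewrite lte_fin.
have : \sum_(0 <= j < 2 ^ K) (2 ^- K : R) = 1.
  by rewrite sumr_const_nat subn0 -[LHS]mulr_natl natrX divff// gt_eqF.
rewrite (bigID B)/= => E1 E2.
have E3 : \sum_(0 <= j < 2 ^ K | B j) (2 ^- K : R) <= 2 ^- (4 * l) by lra.
rewrite -ler_pdivrMl//; apply: le_trans E3.
by rewrite mulr_sumr; apply: ler_sum => j _; rewrite mulr1.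
Qed.

(** * Summation means and limit passages *)

(** Beyond the finite support of row [n] the partial sums are constant. The cutoff depends on the
    row alone, so it serves all points [x] at once. *)
Lemma summation_mean_finite (R : realType) (T : nat -> int -> R[i]^o) (n : nat) :
  finite_set [set m : int | T n m != 0] ->
  exists n0, forall p, (n0 <= p)%N -> forall u : nat -> R,
    summation_mean T u n = \sum_(1 <= k < p) T n k%:Z * (u k)%:C%C.
Proof.
move=> /finite_seqP[s sE]; exists (\max_(z <- s) `|z|%N).+1 => p p0 u.
have T0 k : (p <= k)%N -> T n k%:Z = 0.
  move=> pk; apply/eqP/negPn/negP => Tk.
  have ks : k%:Z \in s by have : [set m : int | T n m != 0] k%:Z by []; rewrite sE.
  have : (absz k%:Z <= \max_(z <- s) absz z)%N by exact: (leq_bigmax_seq (F := absz)).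
  by rewrite leqNgt (leq_trans p0 pk).
apply: lim_near_cst; first exact: norm_hausdorff.
near=> q; have pq : (p <= q)%N by near: q; exact: nbhs_infty_ge.
case: (posnP p) => [p00|pgt0]; first by rewrite p00 in p0.
rewrite (big_cat_nat (n := p))//= [X in _ + X]big_nat_cond [X in _ + X]big1 ?addr0//.
by move=> i /andP[/andP[pi _] _]; rewrite T0// mul0r.
Unshelve. all: by end_near. Qed.

Lemma summation_mean_re (R : realType) (T : nat -> int -> R[i]^o) (n p : nat)
    (u : nat -> R) :
  complex.Re (\sum_(1 <= k < p) T n k%:Z * (u k)%:C%C) =
  \sum_(1 <= k < p) complex.Re (T n k%:Z) * u k.
Proof.
rewrite (raddf_sum (@complex.Re R)); apply: eq_bigr => k _.
by case: (T n k%:Z) => x y /=; rewrite mulr0 subr0.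
Qed.

Lemma normr_re_le (R : realType) (z : R[i]) : `|complex.Re z| <= Normc.normc z.
Proof. by have := normc_ge_Re z; rewrite lecR. Qed.

(** Both sides are values of the outer measure generated by interval length, which is monotone. *)
Lemma completed_lebesgue_measure_le (R : realType) (E F : set R) :
  E `<=` F -> (completed_lebesgue_measure E <= lebesgue_measure F)%E.
Proof.
by move=> EF; apply: (@le_mu_ext _ _ _ (wlength idfun)).
Qed.

(** Continuity from below: if every [F N] had measure at most [r], so would their union, which
    contains [E]. *)
Lemma nondecreasing_cover_gt (R : realType) (E : set R) (F : nat -> set R) (r : R) :
  (r%:E < completed_lebesgue_measure E)%E -> E `<=` \bigcup_N F N ->
  (forall N, measurable (F N)) -> {homo F : p q / (p <= q)%N >-> p `<=` q} ->
  exists N, (r%:E < lebesgue_measure (F N))%E.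
Proof.
move=> Er EF mF ndF; apply: contrapT => nN.
have mU : measurable (\bigcup_N F N) by exact: bigcupT_measurable.
have ndF' : {homo F : p q / (p <= q)%N >-> (p <= q)%O}.
  by move=> p q pq; apply/subsetPset/ndF.
have cF := nondecreasing_cvg_mu mF mU ndF' (mu := lebesgue_measure).
move: (lt_le_trans Er (completed_lebesgue_measure_le EF)); apply/negP; rewrite -leNgt.
rewrite -(cvg_lim _ cF)//; apply: lime_le; first by apply/cvg_ex; eexists; exact: cF.
by near=> q; rewrite leNgt; apply/negP => rq; apply: nN; exists q.
Unshelve. all: by end_near. Qed.

(** Columns converge only one by one, but finitely many are involved: induction on [p] intersects
    their neighbourhoods of infinity. *)
Lemma near_Re_ge_half (R : realType) (T : nat -> int -> R[i]^o) (p : nat) :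
  (forall m : nat, (1 <= m)%N -> T n m%:Z @[n --> \oo] --> (1 : R[i]^o)) ->
  \forall n \near \oo, forall k, (1 <= k < p)%N -> 2^-1 <= complex.Re (T n k%:Z).
Proof.
move=> T1; elim: p => [|p IH]; first by near=> n => k; rewrite ltn0 andbF.
have [->|p0] := posnP p; first by near=> n => k /andP[]; case: k.
have := T1 p p0 => /cvgrPdist_lt /(_ (2^-1 : R)%:C%C).
rewrite ltcR invr_gt0 ltr0n => /(_ isT) Tp.
near=> n => k /andP[k1]; rewrite ltnS leq_eqVlt => /orP[/eqP ->|kp]; last first.
  by move: k k1 kp; near: n; move: IH; apply: filterS => n H k k1 kp; rewrite H// k1.
have : `|1 - T n p%:Z| < (2^-1 : R)%:C%C by near: n.
move=> /(le_lt_trans (normc_ge_Re _)); rewrite ltcR raddfB/=.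
by rewrite ltr_distlC; lra.
Unshelve. all: by end_near. Qed.

Theorem theorem1p5 (R : realType) (l : nat) (m : nat -> nat)
    (T : nat -> int -> R[i]^o) (a : nat -> R) (E : set R) :
  (1 <= l)%N ->
  set_bij [set k : nat | (1 <= k)%N] (Dstar l) m ->
  summation_matrix T ->
  lebesgue_measurable E ->
  E `<=` [set x : R | 0 < x < 1] ->
  ((1 - 2 ^- (4 * l))%:E < completed_lebesgue_measure E)%E ->
  (forall x : R, E x ->
    (ereal_sup [set (Normc.normc
        (summation_mean T (fun k => (a k * walsh (m k) x)%R) n))%:E
      | n in [set n : nat | (1 <= n)%N]] < +oo)%E) ->
  (\sum_(1 <= k <oo) (a k ^+ 2)%:E < +oo)%E.
Proof.
move=> l1 [mD minj _] [Tfin _ T1] _ E01 Ebig Esup.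
pose f n x := complex.Re (summation_mean T (fun k => a k * walsh (m k) x) n).
have fE n : (1 <= n)%N -> exists n0, forall p, (n0 <= p)%N ->
    f n = fun x => \sum_(1 <= k < p) complex.Re (T n k%:Z) * (a k * walsh (m k) x).
  move=> /Tfin/summation_mean_finite[n0 n0P]; exists n0 => p n0p.
  by apply/funext => x; rewrite /f (n0P _ n0p) summation_mean_re.
pose F N := [set x : R | 0 < x < 1] `&`
  \bigcap_(n in [set n | (1 <= n)%N]) [set x | `|f n x| <= N%:R].
have mF N : measurable (F N).
  apply: measurableI.
    by rewrite (_ : [set _ | _] = `]0, 1[%classic).
  apply: bigcap_measurable => [|n /= /fE[n0 /(_ _ (leqnn n0)) ->]]; first by exists 1%N.
  pose g x : R := \sum_(1 <= k < n0) complex.Re (T n k%:Z) * (a k * walsh (m k) x).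
  have mg : measurable_fun setT g.
    apply: measurable_sum => k; apply: measurable_funM => //.
    by apply: measurable_funM => //; exact: measurable_walsh.
  rewrite (_ : [set x | _] = setT `&` g @^-1` `[- N%:R, N%:R]); first exact: mg.
  by rewrite setTI; apply/seteqP; split=> x /=; rewrite in_itv/= ler_norml.
have [N FN] : exists N, ((1 - 2 ^- (4 * l))%:E < lebesgue_measure (F N))%E.
  apply: nondecreasing_cover_gt Ebig _ mF _.
    move=> x Ex; have /(_ x Ex) := Esup.
    set s := ereal_sup _ => s_fin.
    have [N sN] : exists N, (s <= N%:R%:E)%E.
      (* As an extended real, [s] may formally be [-oo]; then [N = 0] will do. *)
      case: s s_fin => [r _||_]; [|by rewrite ltxx|by exists 0%N; rewrite leNye].
      exists (Num.bound `|r|); rewrite lee_fin.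
      by rewrite (le_trans (ler_norm r))// ltW// archi_boundP.
    exists N => //; split; first exact: E01.
    move=> n /= n1; apply: le_trans (normr_re_le _) _; rewrite -lee_fin.
    by apply: le_trans sN; apply: ereal_sup_ubound; exists n.
  move=> p q pq x [x01 H]; split=> // n /H /= /le_trans; apply.
  by rewrite ler_nat.
(* 16 is the 4 of [walsh_coeff_bound] times the 4 lost through [Re t >= 1/2]. [N] is fixed before
   [p], so all partial sums share this bound. *)
suff aN p : \sum_(1 <= k < p) a k ^+ 2 <= 16 * N%:R ^+ 2.
  apply: (@le_lt_trans _ _ (16 * N%:R ^+ 2)%:E); last exact: ltry.
  apply: lime_le; first by apply: is_cvg_nneseries => k _ _; rewrite lee_fin sqr_ge0.
  by near=> p; rewrite sumEFin lee_fin.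
have [n [n1 nT]] : exists n, (1 <= n)%N /\
    forall k, (1 <= k < p)%N -> 2^-1 <= complex.Re (T n k%:Z).
  near \oo => n; exists n; split; first by near: n; exact: nbhs_infty_ge.
  by near: n; exact: near_Re_ge_half.
(* Passing [n0] makes the finite sum equal to the mean; passing [p] keeps all the terms to be
   bounded. *)
have [n0 n0P] := fE n n1; pose q := maxn p n0.
have sumq : \sum_(1 <= k < q) (complex.Re (T n k%:Z) * a k) ^+ 2 <= 4 * N%:R ^+ 2.
  apply: (walsh_coeff_bound l1 minj mD (mF N)) FN _; first exact: subIsetl.
  move=> x [_ /(_ n n1)] /=; rewrite (n0P _ (leq_maxr p n0)) -/q.
  by move=> ?; under eq_bigr do rewrite -mulrA.
have sump : \sum_(1 <= k < p) a k ^+ 2 <=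
    4 * \sum_(1 <= k < q) (complex.Re (T n k%:Z) * a k) ^+ 2.
  have [->|p0] := posnP p.
    by rewrite big_geq// mulr_ge0// sumr_ge0// => k _; exact: sqr_ge0.
  rewrite [X in _ <= _ * X](big_cat_nat (n := p)) ?leq_maxl//= mulrDr ler_wpDr//.
    by rewrite mulr_ge0// sumr_ge0// => k _; exact: sqr_ge0.
  rewrite mulr_sumr !big_nat; apply: ler_sum => k kp.
  have := nT k kp; set t := complex.Re _ => t2.
  rewrite exprMn mulrA ler_peMl ?sqr_ge0//.
  (* This product is [t ^+ 2 - 1/4], the nonlinear fact that [lra] cannot find. *)
  have : 0 <= (t - 2^-1) * (t + 2^-1) by apply: mulr_ge0; lra.
  lra.
lra.
Unshelve. all: by end_near. Qed.
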